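(* Let $n\ge 2$. For every $j=1,\ldots,n-1$, the number $v^n_j$ of plane geometric graphs on $n$ points in convex position whose root vertex has visibility degree $j-1$ is $$v_{j}^{n} = \frac{j}{n-1}2^{n-1-j}\sum_{k=j}^{n-1}\binom{n-1}{k}\binom{n+k-j-2}{k-j}(-1)^{n-1-k}2^{k}.$$
   Context: A geometric graph on a finite point set $\mathcal S\subseteq\mathbb R^2$ has vertex set $\mathcal S$ and edges that are straight-line segments with endpoints in $\mathcal S$; it is plane if no two edges intersect except at common endpoints. The vertices are points $p_1,\dots,p_n$ in convex position labelled in counter-clockwise order, with root vertex $p_n$. Two vertices are visible (from each other) if the line segment connecting them does not intersect the interior of any edge of the graph. The visibility degree of the root vertex $p_n$ is the number of vertices visible from an additional vertex $p_{n+1}$ inserted between $p_n$ and $p_1$ in convex position, minus $2$. *)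

(* Defs.v *)
From mathcomp Require Import all_boot all_order all_algebra.
From mathcomp Require Import boolp classical_sets reals.

Set Implicit Arguments.
Unset Strict Implicit.
Unset Printing Implicit Defensive.

Import Order.TTheory GRing.Theory Num.Theory.
Local Open Scope ring_scope.

(* The points p_1, ..., p_n of the plane are a family p : 'I_n -> 'rV[R]_2
   indexed from 0: p_(i+1) is p i, and the root p_n has index n - 1. *)

Definition closed_segment (R : realType) (x y : 'rV[R]_2) : set 'rV[R]_2 :=
  [set z | exists t : R, 0 <= t <= 1 /\ z = (1 - t) *: x + t *: y]%classic.

Definition open_segment (R : realType) (x y : 'rV[R]_2) : set 'rV[R]_2 :=
  [set z | exists t : R, 0 < t < 1 /\ z = (1 - t) *: x + t *: y]%classic.

(* Twice the signed area of the triangle xyz; positive iff x, y, z is a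
   counter-clockwise turn. *)
Definition orientation (R : realType) (x y z : 'rV[R]_2) : R :=
  (y 0 0 - x 0 0) * (z 0 1 - x 0 1) - (y 0 1 - x 0 1) * (z 0 0 - x 0 0).

(* No point lies in the convex hull of the others (taking a point of the family
   as a hull of one point, this includes distinctness). *)
Definition convex_position (R : realType) (n : nat) (p : 'I_n -> 'rV[R]_2) : Prop :=
  forall i : 'I_n, ~ exists w : 'I_n -> R,
    [/\ forall j, 0 <= w j, w i = 0, \sum_j w j = 1 & p i = \sum_j w j *: p j].

Definition ccw_labelled (R : realType) (n : nat) (p : 'I_n -> 'rV[R]_2) : Prop :=
  forall i j k : 'I_n, (i < j)%N -> (j < k)%N -> 0 < orientation (p i) (p j) (p k).

Definition convex_ccw (R : realType) (n : nat) (p : 'I_n -> 'rV[R]_2) : Prop :=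
  convex_position p /\ ccw_labelled p.

(* The family p_1, ..., p_n, q; when it is in convex position and labelled
   counter-clockwise, q lies between p_n and p_1 in the cyclic order. *)
Definition append_point (R : realType) (n : nat) (p : 'I_n -> 'rV[R]_2)
    (q : 'rV[R]_2) : 'I_n.+1 -> 'rV[R]_2 :=
  fun i => if unlift ord_max i is Some j then p j else q.

(* The edge {p_i, p_j} is recorded once, as the pair (i, j) with i < j. *)
Definition geometric_graph (n : nat) (E : {set 'I_n * 'I_n}) : Prop :=
  forall e, e \in E -> (e.1 < e.2)%N.

Definition plane_graph (R : realType) (n : nat) (p : 'I_n -> 'rV[R]_2)
    (E : {set 'I_n * 'I_n}) : Prop :=
  forall e f, e \in E -> f \in E -> e != f ->
  forall x, closed_segment (p e.1) (p e.2) x -> closed_segment (p f.1) (p f.2) x ->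
  exists v : 'I_n, [/\ v \in [:: e.1; e.2], v \in [:: f.1; f.2] & x = p v].

Definition visible (R : realType) (n : nat) (p : 'I_n -> 'rV[R]_2)
    (E : {set 'I_n * 'I_n}) (x y : 'rV[R]_2) : Prop :=
  forall e, e \in E ->
  forall z, closed_segment x y z -> ~ open_segment (p e.1) (p e.2) z.

(* q stands for p_(n+1). For n >= 2 the subtraction does not truncate, as
   q always sees p_n and p_1. *)
Definition root_visibility_degree (R : realType) (n : nat) (p : 'I_n -> 'rV[R]_2)
    (q : 'rV[R]_2) (E : {set 'I_n * 'I_n}) : nat :=
  (#|[set i : 'I_n | `[< visible p E q (p i) >]]| - 2)%N.

Definition num_plane_graphs (R : realType) (n : nat) (p : 'I_n -> 'rV[R]_2)
    (q : 'rV[R]_2) (d : nat) : nat :=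
  #|[set E : {set 'I_n * 'I_n} |
      `[< [/\ geometric_graph E, plane_graph p E
            & root_visibility_degree p q E = d] >]]|.

(* Main.v *)
(* For points in convex position both planarity and visibility are
   combinatorial: edges cross iff their endpoints interleave, and q sees p_k iff
   no edge (a, b) covers k, that is a < k < b. Adding a last vertex m to a
   noncrossing graph amounts to joining it to an arbitrary set S of uncovered
   vertices, after which exactly m and the old uncovered vertices not beyond
   min S are uncovered. Counting the sets S gives, for the number a(N, j) of
   noncrossing graphs on N + 1 vertices with j + 1 uncovered ones,
     a(N, j) - 2 a(N, j + 1) = 2 (a(N - 1, j - 1) - a(N - 1, j)).
   The right-hand side of the theorem is
     j / N * 2 ^ (N - j) * [w ^ (N - j)] ((2 - w) / (1 - w)) ^ N,  N = n - 1,
   and satisfies the same recurrence. *)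

Require Import Defs.
From mathcomp Require Import boolp classical_sets reals.
From mathcomp Require Import all_boot all_order all_algebra.
From mathcomp Require Import zify ring lra.

Set Implicit Arguments.
Unset Strict Implicit.
Unset Printing Implicit Defensive.

Import Order.TTheory GRing.Theory Num.Theory.
Local Open Scope ring_scope.

(** One-sided: [e] starts first. Quantifying over all ordered pairs of edges restores the
    symmetry. *)
Definition crossing (n : nat) (e f : 'I_n * 'I_n) :=
  (e.1 < f.1 < e.2)%N && (e.2 < f.2)%N.

(** * Orientations and intersections of segments *)

Section Orientation.
Context {R : realType}.
Implicit Types x y z u v : 'rV[R]_2.

Lemma orientation_cycle x y z : orientation x y z = orientation y z x.
Proof. by rewrite /orientation; ring. Qed.

Lemma orientation_swap x y z : orientation x y z = - orientation x z y.
Proof. by rewrite /orientation; ring. Qed.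

Lemma orientation_convex x y u v t :
  orientation x y ((1 - t) *: u + t *: v) =
  (1 - t) * orientation x y u + t * orientation x y v.
Proof. by rewrite /orientation !mxE; ring. Qed.

Lemma orientation_eql x y : orientation x y x = 0.
Proof. by rewrite /orientation; ring. Qed.

Lemma orientation_eqr x y : orientation x y y = 0.
Proof. by rewrite /orientation; ring. Qed.

Lemma orientation_segment x y z :
  closed_segment x y z -> orientation x y z = 0.
Proof.
move=> [t [_ ->]]; rewrite orientation_convex orientation_eql orientation_eqr.
by rewrite !mulr0 addr0.
Qed.

Lemma open_segment_closed x y z : open_segment x y z -> closed_segment x y z.
Proof. by move=> [t [/andP[t0 t1] ->]]; exists t; rewrite !ltW. Qed.

Lemma closed_segmentC x y z : closed_segment x y z -> closed_segment y x z.
Proof.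
move=> [t [/andP[t0 t1] ->]]; exists (1 - t); split; first by lra.
by rewrite subKr addrC.
Qed.

(* The intersection point comes from the affine dependency
   [yzw] x + [xyw] z = [xzw] y + [xyz] w between four points. *)
Lemma diagonals_cross x y z w :
  0 < orientation x y z -> 0 < orientation x y w ->
  0 < orientation x z w -> 0 < orientation y z w ->
  exists2 c, open_segment x z c & open_segment y w c.
Proof.
move=> xyz xyw xzw yzw.
have e : orientation y z w + orientation x y w =
         orientation x z w + orientation x y z.
  by rewrite /orientation; ring.
have d1 : 0 < orientation y z w + orientation x y w by rewrite addr_gt0.
have d2 : 0 < orientation x z w + orientation x y z by rewrite addr_gt0.
have n1 := lt0r_neq0 d1; have n2 := lt0r_neq0 d2.
exists ((1 - orientation x y w / (orientation y z w + orientation x y w)) *: x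
   + (orientation x y w / (orientation y z w + orientation x y w)) *: z).
  exists (orientation x y w / (orientation y z w + orientation x y w)).
  by split=> //; rewrite divr_gt0// ltr_pdivrMr// mul1r ltrDr yzw.
exists (orientation x y z / (orientation x z w + orientation x y z)).
split; first by rewrite divr_gt0// ltr_pdivrMr// mul1r ltrDr xzw.
have s1 : 1 - orientation x y w / (orientation y z w + orientation x y w) =
    orientation y z w / (orientation x z w + orientation x y z).
  by rewrite e; rewrite -[1](divff n2) -mulrBl -e addrK.
have s2 : 1 - orientation x y z / (orientation x z w + orientation x y z) =
    orientation x z w / (orientation x z w + orientation x y z).
  by rewrite -[1](divff n2) -mulrBl addrK.
rewrite s1 s2 e; apply: (scalerI n2).
rewrite !scalerDr !scalerA ![_ * (_ / (_ + _))]mulrC !divfK//.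
apply/rowP => i; rewrite !mxE /orientation.
have [->|->] : i = 0 \/ i = 1 by case: i => [[|[|//]]] ?; [left|right]; apply: val_inj.
  by ring.
by ring.
Qed.

End Orientation.

(** * Planarity and visibility in terms of labels *)

Section ConvexPolygon.
Context {R : realType} {n : nat}.
Variables (p : 'I_n -> 'rV[R]_2) (q : 'rV[R]_2).
Hypothesis pccw : ccw_labelled p.
Hypothesis qccw : forall i j : 'I_n, (i < j)%N -> 0 < orientation (p i) (p j) q.

(** For two points [ccw_labelled p] is void, so distinctness is read off the positively oriented
    triangles with apex [q]. *)
Lemma polygon_injective : injective p.
Proof.
move=> i k pik; apply: val_inj; have [ik|ki|//] := ltngtP i k.
  by move: (qccw ik); rewrite pik orientation_cycle orientation_eql ltxx.
by move: (qccw ki); rewrite pik orientation_cycle orientation_eql ltxx.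
Qed.

Lemma inside_orientation (a b k : 'I_n) :
  (a < k < b)%N -> orientation (p a) (p b) (p k) < 0.
Proof.
by move=> /andP[ak kb]; rewrite orientation_swap oppr_lt0 pccw.
Qed.

Lemma outside_orientation (a b k : 'I_n) :
  (a < b)%N -> (k < a)%N || (b < k)%N -> 0 < orientation (p a) (p b) (p k).
Proof.
move=> ab /orP[ka|bk]; last exact: pccw.
by rewrite -orientation_cycle pccw.
Qed.

(** The line through the ends of [e] separates the labels strictly between them from those outside.
    Without a crossing, both ends of [f] lie weakly on one side, and not both on the line since [e]
    and [f] differ. Hence [f] can meet the line only at an end of [f]. *)
Lemma noncrossing_segments (e f : 'I_n * 'I_n) x :
  (e.1 < e.2)%N -> (f.1 < f.2)%N -> e != f ->
  ~~ crossing e f -> ~~ crossing f e ->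
  closed_segment (p e.1) (p e.2) x -> closed_segment (p f.1) (p f.2) x ->
  exists2 v, v \in [:: f.1; f.2] & x = p v.
Proof.
case: e f => [a b] [c d]; rewrite /crossing /= => ab cd nef ef fe.
move=> /orientation_segment + [t [/andP[t0 t1] xE]].
rewrite xE orientation_convex => o0.
have [t00|tn0] := eqVneq t 0.
  by exists c; rewrite ?inE ?eqxx// t00 subr0 scale1r scale0r addr0.
have [t11|tn1] := eqVneq t 1.
  by exists d; rewrite ?inE ?eqxx ?orbT// t11 subrr scale1r scale0r add0r.
have tp : 0 < t by rewrite lt0r tn0.
have t1p : 0 < 1 - t by rewrite subr_gt0 lt_neqAle tn1.
have ond (k : 'I_n) : ~~ ((a < k < b)%N) -> 0 <= orientation (p a) (p b) (p k).
  move=> nk; have [->|/eqP ka] := eqVneq k a; first by rewrite orientation_eql.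
  have [->|/eqP kb] := eqVneq k b; first by rewrite orientation_eqr.
  apply/ltW/outside_orientation => //.
  have : nat_of_ord k <> a by move=> /val_inj.
  have : nat_of_ord k <> b by move=> /val_inj.
  by lia.
have ind (k : 'I_n) : (a <= k <= b)%N -> orientation (p a) (p b) (p k) <= 0.
  move=> nk; have [->|/eqP ka] := eqVneq k a; first by rewrite orientation_eql.
  have [->|/eqP kb] := eqVneq k b; first by rewrite orientation_eqr.
  apply/ltW/inside_orientation => //.
  have : nat_of_ord k <> a by move=> /val_inj.
  have : nat_of_ord k <> b by move=> /val_inj.
  by lia.
exfalso.
have [cin|cout] := boolP (a < c < b)%N.
  have := inside_orientation cin.
  have := ind d; have -> : (a <= d <= b)%N by lia.
  by move=> /(_ isT) *; nra.
have [din|dout] := boolP (a < d < b)%N.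
  have := inside_orientation din.
  have := ind c; have -> : (a <= c <= b)%N by lia.
  by move=> /(_ isT) *; nra.
have := ond _ cout; have := ond _ dout => oc od.
have [hc|] := boolP ((c < a) || (b < c))%N.
  by have := outside_orientation ab hc; nra.
have [hd|] := boolP ((d < a) || (b < d))%N.
  by have := outside_orientation ab hd; nra.
move=> h1 h2; move: nef; rewrite xpair_eqE -!val_eqE /=; lia.
Qed.

Lemma plane_graphP (E : {set 'I_n * 'I_n}) : geometric_graph E ->
  plane_graph p E <-> {in E &, forall e f, ~~ crossing e f}.
Proof.
move=> gE; split=> [plE e f eE fE|ncE e f eE fE ef x xe xf].
  apply/negP => /andP[/andP[e1f1 f1e2] e2f2].
  have e1e2 := ltn_trans e1f1 f1e2; have f1f2 := ltn_trans f1e2 e2f2.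
  have e1f2 := ltn_trans e1e2 e2f2.
  have [c ce cf] := diagonals_cross
    (pccw e1f1 f1e2) (pccw e1f1 f1f2)
    (pccw e1e2 e2f2) (pccw f1e2 e2f2).
  have nef : e != f by apply: contraTneq e1f1 => ->; rewrite ltnn.
  have [v [+ + _]] := plE e f eE fE nef c
    (open_segment_closed ce) (open_segment_closed cf).
  rewrite !inE -!val_eqE /=; lia.
have [v vf xv] := noncrossing_segments (gE _ eE) (gE _ fE) ef
  (ncE _ _ eE fE) (ncE _ _ fE eE) xe xf.
(* Exchanging the roles of [e] and [f] makes [x] an end of [e] too; injectivity of [p] identifies
   the two vertices. *)
rewrite eq_sym in ef.
have [u ue xu] := noncrossing_segments (gE _ fE) (gE _ eE) ef
  (ncE _ _ fE eE) (ncE _ _ eE fE) xf xe.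
by exists u; split=> //; rewrite (@polygon_injective u v) // -xu.
Qed.

(** If (a, b) covers k, then a, k, b, q form a convex quadrilateral whose diagonals cross.
    Conversely, the line through [p k] and [q] separates smaller labels from larger ones, so the
    interior of an edge not covering k misses it. *)
Lemma visibleP (E : {set 'I_n * 'I_n}) (k : 'I_n) : geometric_graph E ->
  visible p E q (p k) <-> {in E, forall e : 'I_n * 'I_n, ~~ (e.1 < k < e.2)%N}.
Proof.
move=> gE; split=> [vis [a b] eE|ncE [a b] eE z /closed_segmentC zq [t []]] /=.
  apply/negP => /andP[ak kb].
  have [c cab ckq] := diagonals_cross
    (pccw ak kb) (qccw ak) (qccw (ltn_trans ak kb)) (qccw kb).
  by apply: (vis _ eE c) => //; apply/closed_segmentC/open_segment_closed.
move=> /andP[t0 t1] zE; have := orientation_segment zq.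
rewrite zE orientation_convex; have := ncE _ eE; have /= := gE _ eE => ab kab.
have qlt (i : 'I_n) : (k < i)%N -> orientation (p k) q (p i) < 0.
  by move=> ki; rewrite orientation_swap oppr_lt0 qccw.
have qgt (i : 'I_n) : (i < k)%N -> 0 < orientation (p k) q (p i).
  by move=> ik; rewrite -orientation_cycle qccw.
have [ka|ak|/val_inj ka] := ltngtP k a.
- by have := qlt _ ka; have := qlt _ (ltn_trans ka ab); nra.
- have [bk|kb|/val_inj bk] := ltngtP b k.
  + by have := qgt _ ak; have := qgt _ bk; nra.
  + by rewrite ak kb in kab.
  + by have := qgt _ ak; rewrite bk orientation_eql; nra.
- by have := qlt b; rewrite ka ab orientation_eql => /(_ isT); nra.
Qed.

End ConvexPolygon.

Local Open Scope nat_scope.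

(** * Counting noncrossing graphs by adding a last vertex *)

Section Count.
Variable n : nat.
Implicit Types (U S : {set 'I_n}) (E : {set 'I_n * 'I_n}) (m : 'I_n).

(* When a new last vertex is joined to the vertices of S, the uncovered vertices
   in lower U S are those of U that stay uncovered. *)
Definition lower U S := [set u in U | [forall a in S, u <= a]].

(** For r >= 1 this is 2 ^ (s - r) when r < s, 2 when r = s, and 0 beyond: sets whose least element
    is the r-th one of an s-element set, together with the empty set when r = s. *)
Fixpoint lower_count s r :=
  match s, r with
  | 0, _ => (r == 0 : nat)
  | s'.+1, 0 => 0
  | s'.+1, r'.+1 => (r' == 0) * 2 ^ s' + lower_count s' r'
  end.

Lemma card_lower_eq U r :
  #|[set S in powerset U | #|lower U S| == r]| = lower_count #|U| r.
Proof.
move sE : #|U| => s; elim: s U sE r => [|s IHs] U sE r.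
  move/eqP: sE; rewrite cards_eq0 => /eqP ->.
  rewrite (_ : [set _ in _ | _] = if r == 0 then [set set0] else set0).
    by case: r => [|r] /=; rewrite ?cards1 ?cards0.
  apply/setP => S; rewrite powerset0 !inE (_ : lower set0 S = set0).
    by rewrite cards0 [0 == r]eq_sym; case: (r == 0); rewrite ?inE ?andbT ?andbF.
  by apply/setP => x; rewrite !inE.
have [x0 x0U] : exists x, x \in U by apply/card_gt0P; rewrite sE.
have [y yU ymin] : exists2 y, y \in U & forall a, a \in U -> y <= a.
  by case: (arg_minnP (fun i : 'I_n => i : nat) x0U) => y yU ymin; exists y.
have sE' : #|U :\ y| = s by move: (cardsD1 y U); rewrite yU sE => -[].
have low_in S : S \subset U -> y \in S -> lower U S = [set y].
  move=> /subsetP SU yS; apply/setP => u; rewrite !inE.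
  apply/andP/eqP => [[uU /'forall_implyP/(_ y yS) uy]|->].
    by apply/val_inj/eqP; rewrite eqn_leq uy ymin.
  by split=> //; apply/'forall_implyP => a /SU /ymin.
have low_notin S : S \subset U -> y \notin S ->
    lower U S = y |: lower (U :\ y) S.
  move=> /subsetP SU yS; apply/setP => u; rewrite !inE.
  have [->|//] := eqVneq u y; rewrite yU /=.
  by apply/'forall_implyP => a /SU /ymin.
(* If the least element y is in S, only y survives and the rest of S is free; otherwise y survives
   and the count continues in [U :\ y]. *)
rewrite -sum1dep_card (bigID (fun S => y \in S)) /=.
case: r => [|r] /=.
  rewrite !big1 // => S; rewrite inE => /andP[/andP[SU S0] yS].
    by move: S0; rewrite low_notin // cardsU1 !inE eqxx.
  by move: S0; rewrite low_in // cards1.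
congr addn.
  have [->|r0] := eqVneq r 0; last first.
    rewrite big1 // => S; rewrite inE => /andP[/andP[SU S0] yS].
    by move: S0; rewrite low_in // cards1 eqSS eq_sym (negPf r0).
  rewrite mul1n -sE' -card_powerset -sum1_card.
  rewrite (reindex_onto (fun S => y |: S) (fun S => S :\ y)) /=; last first.
    by move=> S /andP[_ yS]; rewrite setD1K.
  apply: eq_bigl => S; rewrite !inE eqxx /= andbT subsetD1.
  have [yS|yS] := boolP (y \in S).
    rewrite andbF; apply/negP => /andP[_ /eqP SE].
    by move: yS; rewrite -SE !inE eqxx.
  rewrite setU1K // eqxx !andbT subUset sub1set yU /=.
  have [SU|//] := boolP (S \subset U).
  by rewrite low_in ?cards1 ?setU11 // subUset sub1set yU.
rewrite -(IHs _ sE') -sum1dep_card; apply: eq_bigl => S; rewrite !inE subsetD1.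
have [SU|//] := boolP (S \subset U); have [yS|yS] := boolP (y \in S).
  by rewrite andbF.
by rewrite andbT low_notin // cardsU1 !inE eqxx.
Qed.

(** Consecutive values halve; the indicators correct the two boundary cases s = r + 1 and s = r + 2.
    Summed over graphs, they become counts with one vertex fewer. *)
Lemma lower_countS s r :
  lower_count s r.+1 + 2 * (s == r.+2) =
  2 * (s == r.+1) + 2 * lower_count s r.+2.
Proof.
elim: s r => [|s IHs] r //=; rewrite !eqSS mul0n add0n.
case: r => [|r]; last by rewrite /= mul0n add0n IHs.
rewrite mul1n; case: s IHs => [|s] //= IHs.
by rewrite expnS; case: s {IHs} => [|s] /=; lia.
Qed.

Definition covered E (i : nat) := [exists e in E, e.1 < i < e.2].

(** Graphs on the first k labels all live in the same type over ['I_n], so adding a vertex changes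
    no type. *)
Definition ncgraphs k := [set E : {set 'I_n * 'I_n} |
  [forall e in E, (e.1 < e.2 < k) && [forall f in E, ~~ crossing e f]]].

Definition uncovered k E : {set 'I_n} := [set i : 'I_n | (i < k) && ~~ covered E i].

Definition ncgraph_count k s := #|[set E in ncgraphs k | #|uncovered k E| == s]|.

Lemma ncgraphsP k E :
  reflect ((forall e, e \in E -> e.1 < e.2 < k) /\ {in E &, forall e f, ~~ crossing e f})
    (E \in ncgraphs k).
Proof.
rewrite inE; apply: (iffP 'forall_implyP) => [H|[H1 H2] e eE].
  split=> [e|e f] eE; first by case/andP: (H e eE).
  by case/andP: (H e eE) => _ /'forall_implyP; apply.
by rewrite H1 //=; apply/'forall_implyP => f; apply: H2.
Qed.

Definition fan m S := [set (a, m) | a in S].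
Definition old_edges m E := [set e in E | e.2 < m].
Definition neighbours m E := [set a | (a, m) \in E].

Lemma in_fan m S e : (e \in fan m S) = (e.1 \in S) && (e.2 == m).
Proof.
apply/imsetP/andP => [[a aS ->] //|[e1 /eqP em]].
by exists e.1 => //; case: e {e1} em => a b /= ->.
Qed.

(** An edge (a, m) crosses an old edge exactly when that edge covers a, and edges sharing the end m
    never cross. *)
Lemma ncgraphs_fan m E S : E \in ncgraphs m ->
  (E :|: fan m S \in ncgraphs m.+1) = (S \subset uncovered m E).
Proof.
move=> /ncgraphsP[Em Enc]; apply/ncgraphsP/subsetP => [[H Hnc] a aS|SU].
  have aE : (a, m) \in E :|: fan m S by rewrite inE in_fan /= aS eqxx orbT.
  rewrite inE; have /= := H _ aE; rewrite ltnSn andbT => am; rewrite am /=.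
  apply/existsP => -[e /andP[eE /andP[ea ae]]].
  have eE' : e \in E :|: fan m S by rewrite inE eE.
  have := Hnc _ _ eE' aE; rewrite /crossing /= ea ae /=.
  by case/andP: (Em _ eE) => _ ->.
split=> [e|e f].
  rewrite inE in_fan => /orP[/Em|/andP[/SU]]; first by lia.
  by rewrite inE => /andP[em _] /eqP ->; rewrite em /=.
rewrite !inE !in_fan => /orP[eE|/andP[eS /eqP em]] /orP[fE|/andP[fS /eqP fm]].
- exact: Enc.
- have := SU _ fS; rewrite inE => /andP[_]; apply: contra.
  by move=> /andP[ef _]; apply/existsP; exists e; rewrite eE.
- case/andP: (Em _ fE) => _ fm; rewrite /crossing em; apply/negP => /andP[_ /(ltn_trans fm)].
  by rewrite ltnn.
- by rewrite /crossing em fm ltnn andbF.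
Qed.

Lemma uncovered_fan m E S : E \in ncgraphs m -> S \subset uncovered m E ->
  uncovered m.+1 (E :|: fan m S) = m |: lower (uncovered m E) S.
Proof.
move=> /ncgraphsP[Em Enc] /subsetP SU; apply/setP => u; rewrite !inE.
have [->|num] := eqVneq u m.
  rewrite ltnSn /=; apply/existsP => -[e /andP[]].
  rewrite inE in_fan => /orP[/Em|/andP[_ /eqP ->]]; last by rewrite ltnn andbF.
  by lia.
rewrite ltnS leq_eqVlt (negPf (_ : (u : nat) != m)) //=.
have [um|//] := boolP (u < m); rewrite /=.
apply/idP/andP => [cov|[nc /'forall_implyP uS]].
  split; first apply: contra cov => /existsP[e /andP[eE eu]].
    by apply/existsP; exists e; rewrite inE eE.
  apply/'forall_implyP => a aS; rewrite leqNgt; apply: contra cov => au.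
  by apply/existsP; exists (a, m); rewrite inE in_fan /= aS eqxx orbT au.
apply/existsP => -[e /andP[]]; rewrite inE in_fan => /orP[eE eu|/andP[/uS]].
  by move/existsP: nc; apply; exists e; rewrite eE.
by move=> ue _ /andP[]; rewrite ltnNge ue.
Qed.

Lemma old_edges_fan m E S : E \in ncgraphs m -> old_edges m (E :|: fan m S) = E.
Proof.
move=> /ncgraphsP[Em _]; apply/setP => e; rewrite !inE in_fan.
have [/Em|_] := boolP (e \in E); first by lia.
by have [->|] := eqVneq e.2 m; rewrite ?ltnn ?andbF.
Qed.

Lemma neighbours_fan m E S : E \in ncgraphs m -> neighbours m (E :|: fan m S) = S.
Proof.
move=> /ncgraphsP[Em _]; apply/setP => a; rewrite !inE in_fan /= eqxx andbT.
by have [/Em|//] := boolP ((a, m) \in E); rewrite ltnn andbF.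
Qed.

Lemma old_edges_ncgraphs m E : E \in ncgraphs m.+1 -> old_edges m E \in ncgraphs m.
Proof.
move=> /ncgraphsP[Em Enc]; apply/ncgraphsP; split=> [e|e f].
  by rewrite inE => /andP[/Em]; lia.
by rewrite !inE => /andP[eE _] /andP[fE _]; apply: Enc.
Qed.

Lemma old_edgesK m E : E \in ncgraphs m.+1 ->
  old_edges m E :|: fan m (neighbours m E) = E.
Proof.
move=> /ncgraphsP[Em Enc]; apply/setP => -[a b]; rewrite !inE in_fan inE /=.
have [->|nbm] := eqVneq b m; first by rewrite ltnn !andbF andbT.
rewrite andbF orbF; have [/Em|//] := boolP ((a, b) \in E).
by move: nbm; rewrite -val_eqE /=; lia.
Qed.

(** A graph on m + 1 vertices amounts to its old edges and the neighbour set S of the new vertex.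
    That vertex is itself uncovered, whence the shift from r + 1 to r. *)
Lemma ncgraph_countS m r :
  ncgraph_count m.+1 r.+1 =
  \sum_(E in ncgraphs m) lower_count #|uncovered m E| r.
Proof.
rewrite /ncgraph_count -sum1dep_card.
rewrite (partition_big (old_edges m) (mem (ncgraphs m))) /=; last first.
  by move=> E /andP[/old_edges_ncgraphs].
apply: eq_bigr => E Enc; rewrite -card_lower_eq -sum1dep_card.
rewrite (reindex_onto (fun S => E :|: fan m S) (neighbours m)) /=; last first.
  by move=> F /andP[/andP[Fnc _] /eqP <-]; rewrite old_edgesK.
apply: eq_bigl => S; rewrite old_edges_fan // neighbours_fan // !eqxx !andbT.
rewrite ncgraphs_fan // inE; have [SU|//] := boolP (S \subset _).
by rewrite uncovered_fan // cardsU1 !inE ltnn.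
Qed.

Lemma ncgraph_count_sum k s :
  ncgraph_count k s = \sum_(E in ncgraphs k) (#|uncovered k E| == s).
Proof. by rewrite /ncgraph_count -sum1dep_card big_mkcondr. Qed.

(** The recurrence for a(N, j) at N = m and j = r + 1, with negative terms moved across to stay in
    [nat]. *)
Lemma ncgraph_count_rec m r :
  ncgraph_count m.+1 r.+2 + 2 * ncgraph_count m r.+2 =
  2 * ncgraph_count m r.+1 + 2 * ncgraph_count m.+1 r.+3.
Proof.
rewrite !ncgraph_countS !ncgraph_count_sum !big_distrr /= -!big_split /=.
by apply: eq_bigr => E _; apply: lower_countS.
Qed.

Lemma uncovered_endpoints k E (hk : 1 < k <= n) : E \in ncgraphs k -> 1 < #|uncovered k E|.
Proof.
move=> /ncgraphsP[Em _].
have h0 : 0 < n by lia.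
have h1 : k.-1 < n by lia.
apply/card_gt1P; exists (Ordinal h0), (Ordinal h1).
rewrite -val_eqE !inE /=; split; try by lia.
  by apply/andP; split; [lia | apply/existsP => -[e /andP[]]; lia].
apply/andP; split; first by lia.
by apply/existsP => -[e /andP[/Em]]; lia.
Qed.

Lemma ncgraph_count_gt k s : k < s -> k <= n -> ncgraph_count k s = 0.
Proof.
move=> ks kn; apply/eqP; rewrite cards_eq0; apply/eqP/setP => E; rewrite !inE.
apply/negP => /andP[_ /eqP Es].
have : #|uncovered k E| <= #|[set widen_ord kn i | i : 'I_k]|.
  apply/subset_leq_card/subsetP => i; rewrite inE => /andP[ik _].
  by apply/imsetP; exists (Ordinal ik) => //; apply: val_inj.
rewrite card_imset ?cardsT ?card_ord; first by lia.
by move=> i j /(congr1 val) /= /val_inj.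
Qed.

Lemma ncgraph_count1 k : 1 < k <= n -> ncgraph_count k 1 = 0.
Proof.
move=> hk; rewrite ncgraph_count_sum big1 // => E /(uncovered_endpoints hk).
by case: eqP => // ->.
Qed.

Lemma ncgraph_count11 : 0 < n -> ncgraph_count 1 1 = 1.
Proof.
move=> n0; rewrite (ncgraph_countS (Ordinal n0) 0) /= (big_pred1 set0) => [|E].
  by rewrite (_ : uncovered 0 set0 = set0) ?cards0 //; apply/setP => i; rewrite !inE.
apply/ncgraphsP/eqP => [[H _]|->]; last by split=> e; rewrite inE.
by apply/setP => e; rewrite inE; apply/negP => /H; rewrite ltn0 andbF.
Qed.

End Count.

Local Open Scope ring_scope.

(** * Power series coefficients and the closed formula *)

(** The coefficient of w ^ M in ((2 - w) / (1 - w)) ^ N, as a convolution of (2 - w) ^ N with (1 -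
    w) ^ (- N). The truncated predecessor gives the right values at N = 0 as well. *)
Definition quotient_coef (N M : nat) : rat :=
  \sum_(i < M.+1) 'C(N, i)%:R * (-1) ^+ i * 2 ^+ (N - i) * 'C((N + (M - i)).-1, M - i)%:R.

Lemma quotient_coef0 N : quotient_coef N 0 = 2 ^+ N.
Proof. by rewrite /quotient_coef big_ord1 /= !subn0 !bin0 expr0 !mul1r mulr1. Qed.

(* phi = (2 - w) / (1 - w) satisfies (1 - w) phi ^ (N + 1) = (2 - w) phi ^ N. *)
Lemma quotient_coefS N M :
  quotient_coef N.+1 M.+1 =
  quotient_coef N.+1 M + 2 * quotient_coef N M.+1 - quotient_coef N M.
Proof.
pose a n i : rat := 'C(n, i)%:R * (-1) ^+ i * 2 ^+ (n - i).
have a0 n : a n.+1 0 = 2 * a n 0.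
  by rewrite /a !bin0 !subn0 exprS; ring.
have aS n i : a n.+1 i.+1 = 2 * a n i.+1 - a n i.
  rewrite /a subSS binS natrD [(-1) ^+ i.+1]exprS.
  (* For n <= i the exponent n - (i + 1) truncates, but its binomial factor vanishes. *)
  have [ni|ni] := ltnP i n; last by rewrite (@bin_small n i.+1) //; ring.
  by rewrite -(subnSK ni) exprS; ring.
pose h n m : rat := 'C((n + m).-1, m)%:R.
have h0 n : h n 0 = 1 by rewrite /h bin0.
have hS n m : h n.+1 m.+1 = h n.+1 m + h n m.+1.
  by rewrite /h !addSn !addnS /= binS natrD addrC.
have qE n m : quotient_coef n m = \sum_(i < m.+1) a n i * h n (m - i)%N by [].
(* Multiplying by 1 - w removes one power of the denominator ([hS]); [aS] then splits a factor 2 - w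
   off the numerator. *)
have diff : quotient_coef N.+1 M.+1 - quotient_coef N.+1 M =
    \sum_(i < M.+2) a N.+1 i * h N (M.+1 - i)%N.
  rewrite !qE big_ord_recr [in RHS]big_ord_recr /= subnn !h0 addrAC -sumrB.
  congr (_ + _); apply: eq_bigr => i _.
  have iM : (i <= M)%N by rewrite -ltnS.
  by rewrite subSn // hS; ring.
apply/eqP; rewrite -addrA addrC -subr_eq diff; apply/eqP.
rewrite big_ord_recl a0 !qE [in RHS]big_ord_recl mulrDr -mulrA -addrA.
congr (_ + _); rewrite mulr_sumr -sumrB; apply: eq_bigr => i _.
by rewrite lift0 aS subSS; ring.
Qed.

(* Coefficients of N phi ^ (N + 1) = (2 - w) (phi ^ N)' + N phi ^ N. The defect D_N
   of this identity satisfies (1 - w) D_(N + 1) = (2 - w) D_N, hence the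
   induction needs no other input than quotient_coefS. *)
Lemma quotient_coef_deriv N M :
  N%:R * quotient_coef N.+1 M =
  2 * M.+1%:R * quotient_coef N M.+1 + (N%:R - M%:R) * quotient_coef N M.
Proof.
have q0M k : quotient_coef 0 k = (k == 0%N)%:R.
  rewrite /quotient_coef big_ord_recl big1 => [|i _].
    by rewrite addr0 /= !subn0 add0n bin0 !mul1r; case: k => //= k; rewrite bin_small.
  by rewrite bin0n /= !mul0r.
elim: N M => [|N IHN] M.
  by rewrite !q0M; case: M => [|M]; rewrite /= ?mulr0 ?subrr ?mul0r ?addr0.
elim: M => [|M IHM].
  move: (IHN 0%N); rewrite !quotient_coefS !quotient_coef0 !exprS => IH.
  rewrite -!natr1 in IH *; nra.
have := IHN M; have := IHN M.+1; move: IHM.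
rewrite !(quotient_coefS N.+1) !(quotient_coefS N) -!natr1.
move=> *; nra.
Qed.

Definition visibility_formula (N j : nat) : rat :=
  j%:R / N%:R * 2 ^+ (N - j) * quotient_coef N (N - j).

Lemma visibility_formula0 N : visibility_formula N 0 = 0.
Proof. by rewrite /visibility_formula !mul0r. Qed.

Lemma visibility_formula_diag N : visibility_formula N.+1 N.+1 = 2 ^+ N.+1.
Proof.
by rewrite /visibility_formula subnn quotient_coef0 divff ?pnatr_eq0 // !mul1r.
Qed.

Lemma visibility_formula_rec N j : (j < N.+1)%N ->
  visibility_formula N.+2 j.+1 =
  2 * visibility_formula N.+2 j.+2
  + 2 * (visibility_formula N.+1 j - visibility_formula N.+1 j.+1).
Proof.
rewrite ltnS => jN; rewrite /visibility_formula !subSS (subSn jN).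
have [M NE] : exists M, N = (j + M)%N by exists (N - j)%N; rewrite subnKC.
have -> : (N - j)%N = M by rewrite NE addKn.
have := quotient_coef_deriv N.+1 M; have := quotient_coefS N.+1 M.
rewrite exprS; set t := 2 ^+ M.
set x := quotient_coef N.+2 M.+1; set y := quotient_coef N.+2 M.
set z := quotient_coef N.+1 M.+1; set w := quotient_coef N.+1 M.
have n1 : N.+1%:R != 0 :> rat by rewrite pnatr_eq0.
have n2 : N.+2%:R != 0 :> rat by rewrite pnatr_eq0.
have Me : M%:R = N%:R - j%:R :> rat by rewrite NE natrD addrC addKr.
(* [quotient_coefS] eliminates x and [quotient_coef_deriv] eliminates y, leaving a rational identity
   in z and w. *)
move: n1 n2; rewrite -!natr1 Me => n1 n2 -> /(canRL (mulKf n1)) ->.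
by field; rewrite n1 n2.
Qed.

Lemma visibility_formulaE N j : (j <= N)%N ->
  visibility_formula N j =
  j%:R / N%:R * 2 ^+ (N - j) *
  \sum_(j <= k < N.+1)
    'C(N, k)%:R * 'C(N.+1 + k - j - 2, k - j)%:R * (-1) ^+ (N - k) * 2 ^+ k.
Proof.
(* The convolution index is i = N - k. *)
move=> jN; congr (_ * _); rewrite big_nat_rev /= -[X in index_iota X _]add0n big_addn.
rewrite subSn // big_mkord; apply: eq_bigr => i _.
have iN : (i <= N - j)%N by rewrite -ltnS.
have -> : (j + N.+1 - (i + j).+1)%N = (N - i)%N by lia.
have -> : (N - (N - i))%N = i by lia.
have -> : (N - i - j)%N = (N - j - i)%N by lia.
have -> : (N.+1 + (N - i) - j - 2)%N = (N + (N - j - i)).-1 by lia.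
by rewrite bin_sub; [ring|lia].
Qed.

(** Induction on N, then downwards on j, since the recurrence reaches j from j + 1 at the same N. At
    the top value of j the terms with more uncovered vertices than vertices vanish, so both sides
    double with N; at j = 0 both are zero. *)
Lemma ncgraph_count_formula n N j : (N.+1 < n)%N -> (j <= N.+1)%N ->
  (ncgraph_count n N.+2 j.+1)%:R = visibility_formula N.+1 j.
Proof.
elim: N j => [|N IHN] j Nn.
  have := ncgraph_count_rec (Ordinal Nn) 0 => /=.
  rewrite ncgraph_count11 ?(@ncgraph_count_gt _ 1 2) ?(@ncgraph_count_gt _ 2 3) //;
    try exact: ltnW.
  rewrite !muln0 !addn0 => W2; case: j => [|[|//]] _.
    by rewrite ncgraph_count1 // visibility_formula0.
  by rewrite W2 visibility_formula_diag.
have Nn' := ltnW Nn.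
move dE : (N.+2 - j)%N => d; elim: d j dE => [|d IHd] j dE jN.
  have -> : j = N.+2 by lia.
  have := ncgraph_count_rec (Ordinal Nn) N.+1 => /=.
  rewrite (@ncgraph_count_gt _ N.+2 N.+3) // (@ncgraph_count_gt _ N.+3 N.+4) //.
  rewrite !muln0 !addn0 => ->.
  by rewrite natrM IHN // !visibility_formula_diag -exprS.
case: j dE jN => [|j] dE jN.
  by rewrite ncgraph_count1 // visibility_formula0.
have jN' : (j < N.+1)%N by lia.
rewrite visibility_formula_rec // -!IHN -?IHd; try lia.
have /(congr1 (fun k => k%:R : rat)) := ncgraph_count_rec (Ordinal Nn) j => /=.
by rewrite !(natrM, natrD); lra.
Qed.

(** * Transfer to geometric graphs *)

Section PolygonCount.
Context {R : realType} {n : nat}.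
Variables (p : 'I_n -> 'rV[R]_2) (q : 'rV[R]_2).

Lemma append_point_ccw : ccw_labelled (append_point p q) ->
  forall i j : 'I_n, (i < j)%N -> 0 < orientation (p i) (p j) q.
Proof.
move=> qccw i j ij.
have := qccw (lift ord_max i) (lift ord_max j) ord_max.
rewrite /append_point !liftK unlift_none !lift_max.
by apply=> //; apply: ltn_ord.
Qed.

Lemma num_plane_graphsE d : (1 < n)%N ->
  convex_ccw p -> convex_ccw (append_point p q) ->
  num_plane_graphs p q d = ncgraph_count n n d.+2.
Proof.
move=> n1 [_ pccw] [_ /append_point_ccw qccw].
apply: eq_card => E; rewrite inE [RHS]inE.
have degE : geometric_graph E ->
    [set i | `[< visible p E q (p i) >]] = uncovered n E.
  move=> gE; apply/setP => i; rewrite !inE ltn_ord /=.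
  apply/asboolP/idP => [/(visibleP pccw qccw i gE) vis|/existsP ncov].
    by apply/existsP => -[e /andP[/vis /negP]].
  apply/(visibleP pccw qccw i gE) => e eE; apply/negP => ei.
  by apply: ncov; exists e; rewrite eE.
apply/asboolP/andP => [[gE plE degd]|[Enc /eqP vis]].
  have Enc : E \in ncgraphs n n.
    apply/ncgraphsP; split; last exact/(plane_graphP pccw qccw gE).
    by move=> e eE; rewrite gE //= ltn_ord.
  split=> //; move: degd; rewrite /root_visibility_degree degE // => <-.
  (* The first and last vertices are always uncovered, so subtracting 2 does not truncate. *)
  have := @uncovered_endpoints n n E; rewrite n1 leqnn => /(_ isT Enc) vis2.
  by rewrite -addn2 subnK.
have /ncgraphsP[En ncE] := Enc.
have gE : geometric_graph E by move=> e /En /andP[].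
split=> //; first exact/(plane_graphP pccw qccw gE).
by rewrite /root_visibility_degree degE // vis subn2.
Qed.

End PolygonCount.

Theorem theorem9 (R : realType) (n : nat) (hn : (2 <= n)%N)
    (p : 'I_n -> 'rV[R]_2) (hp : convex_ccw p)
    (q : 'rV[R]_2) (hq : convex_ccw (append_point p q))
    (j : nat) (hj : (1 <= j <= n - 1)%N) :
  (num_plane_graphs p q (j - 1))%:R =
    j%:R / (n - 1)%:R * 2 ^+ (n - 1 - j) *
    \sum_(j <= k < n)
      'C(n - 1, k)%:R * 'C(n + k - j - 2, k - j)%:R * (-1) ^+ (n - 1 - k) * 2 ^+ k
  :> rat.
Proof.
(* Degree j - 1 means j + 1 uncovered vertices, the indexing of [ncgraph_count_formula]. *)
rewrite num_plane_graphsE //; case: n hn p hp hq hj => [|[|N]] // _ p _ _.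
rewrite subn1 /=; case: j => [|j] //; rewrite subn1 /= => jN.
by rewrite ncgraph_count_formula // visibility_formulaE.
Qed.
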